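(* For $k\ge2$, the set $\mathcal{C}$ is a maximal commutative algebraic system in $\mathcal{P}_{4k+9}( * )$, where $\mathcal{C}:=\bigcup_{i\text{ odd},\ 2k+3\le i\le 4k+9}\mathcal{C}_i$ and the collections $\mathcal{C}_i$ of subsets of $[4k+9]$ are as defined in the context.
   Context: Write $[a]=\{1,\dots,a\}$, $[a,b]=\{a,\dots,b\}$; $\mathcal{P}_n(j)$ is the collection of all subsets of $[n]$ of size $j$, and $\mathcal{P}_n( * )$ is the collection of all nonempty subsets of $[n]$. A nonempty collection $\Delta$ of subsets of $[n]$ of odd size is an algebraic system if for every $A_1\subseteq[n]$ with $|A_1|$ even and every $A_2\in\Delta$ with $A_1\cap A_2=\emptyset$ we have $A_1\cup A_2\in\Delta$. It is commutative if any two elements of $\Delta$ have nonempty intersection. A commutative system $\Delta$ is maximal if for every $A\subseteq[n]$ with $|A|$ odd and $A\notin\Delta$ there is $B\in\Delta$ with $A\cap B=\emptyset$. A maximal commutative algebraic system is an algebraic system that is commutative and maximal. Let $n=4k+9$, $\mathcal{T}'_7=[4k+3,4k+9]$, so $[n]=\mathcal{T}'_7\cup[4k+2]$. Let $A_1=\{4k+3,4k+4,4k+7\}$, $A_2=\{4k+3,4k+5,4k+8\}$, $A_3=\{4k+3,4k+6,4k+9\}$, $A_4=\{4k+4,4k+5,4k+9\}$, $A_5=\{4k+5,4k+6,4k+7\}$, $A_6=\{4k+7,4k+8,4k+9\}$, $A_7=\{4k+4,4k+6,4k+8\}$. Let $E_1=\{4k+3,4k+4,4k+8,4k+9\}$,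 $E_2=\{4k+4,4k+5,4k+7,4k+8\}$, $E_3=\{4k+5,4k+6,4k+8,4k+9\}$, $E_4=\{4k+3,4k+5,4k+7,4k+9\}$, $E_5=\{4k+3,4k+4,4k+5,4k+6\}$, $E_6=\{4k+3,4k+6,4k+7,4k+8\}$, $E_7=\{4k+4,4k+6,4k+7,4k+9\}$, and let $\mathcal{Q}_7(4)$ be the collection of the 28 subsets of $\mathcal{T}'_7$ of size 4 other than $E_1,\dots,E_7$. $\mathcal{C}_{2k+3}$ consists of all sets of size $2k+3$ of one of the forms: $A_i\cup S'$ with $1\le i\le7$, $S'\subset[4k+2]$, $|S'|=2k$; or $S\subset[4k+2]$ with $|S|=2k+3$. $\mathcal{C}_{2k+5}$ consists of all sets of size $2k+5$ of the form $S'\cup S''$ with $S'\subset\mathcal{T}'_7$, $S''\subset[4k+2]$ and one of: $|S'|=0,|S''|=2k+5$; $|S'|=1,|S''|=2k+4$; $|S'|=2,|S''|=2k+3$; $S'\in\{A_1,\dots,A_7\},|S''|=2k+2$; $S'\in\mathcal{Q}_7(4),|S''|=2k+1$; $|S'|=5,|S''|=2k$. For odd $i$ with $2k+7\le i\le n$, $\mathcal{C}_i=\mathcal{P}_n(i)$. *)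

(* Defs.v *)
From mathcomp Require Import all_boot.

Set Implicit Arguments.
Unset Strict Implicit.
Unset Printing Implicit Defensive.

(* The ground set [n] = {1, ..., n} is the type 'I_n, whose underlying values
   are 0, ..., n - 1; [label x] is the element of {1, ..., n} that the ordinal
   [x] stands for. *)
Definition label (n : nat) (x : 'I_n) : nat := x.+1.

Definition segment (n a b : nat) : {set 'I_n} :=
  [set x : 'I_n | a <= label x <= b].

Definition subsets_of_size (T : finType) (A : {set T}) (j : nat) :
  {set {set T}} := [set S : {set T} | (S \subset A) && (#|S| == j)].

Definition P (n j : nat) : {set {set 'I_n}} := subsets_of_size [set: 'I_n] j.

Definition Pstar (n : nat) : {set {set 'I_n}} :=
  [set S : {set 'I_n} | S != set0].

Definition unions (T : finType) (F G : {set {set T}}) : {set {set T}} :=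
  [set S' :|: S'' | S' in F, S'' in G].

Definition algebraic_system (n : nat) (D : {set {set 'I_n}}) : Prop :=
  [/\ D != set0,
      (forall A, A \in D -> odd #|A|)
    & (forall A1 A2 : {set 'I_n}, ~~ odd #|A1| -> A2 \in D ->
         A1 :&: A2 = set0 -> A1 :|: A2 \in D)].

Definition commutative_system (n : nat) (D : {set {set 'I_n}}) : Prop :=
  forall A B, A \in D -> B \in D -> A :&: B != set0.

Definition maximal_system (n : nat) (D : {set {set 'I_n}}) : Prop :=
  forall A : {set 'I_n}, odd #|A| -> A \notin D ->
    exists2 B, B \in D & A :&: B = set0.

Definition maximal_commutative_algebraic_system
    (n : nat) (D : {set {set 'I_n}}) : Prop :=
  [/\ algebraic_system D, commutative_system D & maximal_system D].

Definition low (k : nat) : {set 'I_(4 * k + 9)} := segment _ 1 (4 * k + 2).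

Definition T7 (k : nat) : {set 'I_(4 * k + 9)} :=
  segment _ (4 * k + 3) (4 * k + 9).

(* [block k [:: a; b; ...]] is the set {4k+a, 4k+b, ...}. *)
Definition block (k : nat) (s : seq nat) : {set 'I_(4 * k + 9)} :=
  [set x | label x \in [seq 4 * k + a | a <- s]].

(* A_1, ..., A_7, in this order: the lines of a Fano plane on [T7 k]. *)
Definition A_family (k : nat) : {set {set 'I_(4 * k + 9)}} :=
  [set block k [:: 3; 4; 7]; block k [:: 3; 5; 8]; block k [:: 3; 6; 9];
       block k [:: 4; 5; 9]; block k [:: 5; 6; 7]; block k [:: 7; 8; 9];
       block k [:: 4; 6; 8]].

(* E_1, ..., E_7, in this order: the complements in [T7 k] of the lines. *)
Definition E_family (k : nat) : {set {set 'I_(4 * k + 9)}} :=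
  [set block k [:: 3; 4; 8; 9]; block k [:: 4; 5; 7; 8];
       block k [:: 5; 6; 8; 9]; block k [:: 3; 5; 7; 9];
       block k [:: 3; 4; 5; 6]; block k [:: 3; 6; 7; 8];
       block k [:: 4; 6; 7; 9]].

Definition Q7_4 (k : nat) : {set {set 'I_(4 * k + 9)}} :=
  subsets_of_size (T7 k) 4 :\: E_family k.

Definition C_2k3 (k : nat) : {set {set 'I_(4 * k + 9)}} :=
  P _ (2 * k + 3) :&:
    (unions (A_family k) (subsets_of_size (low k) (2 * k))
     :|: subsets_of_size (low k) (2 * k + 3)).

Definition C_2k5 (k : nat) : {set {set 'I_(4 * k + 9)}} :=
  P _ (2 * k + 5) :&:
    (unions (subsets_of_size (T7 k) 0) (subsets_of_size (low k) (2 * k + 5))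
     :|: unions (subsets_of_size (T7 k) 1) (subsets_of_size (low k) (2 * k + 4))
     :|: unions (subsets_of_size (T7 k) 2) (subsets_of_size (low k) (2 * k + 3))
     :|: unions (A_family k) (subsets_of_size (low k) (2 * k + 2))
     :|: unions (Q7_4 k) (subsets_of_size (low k) (2 * k + 1))
     :|: unions (subsets_of_size (T7 k) 5) (subsets_of_size (low k) (2 * k))).

(* Only meaningful for odd i with 2k+3 <= i <= 4k+9. *)
Definition C_ (k i : nat) : {set {set 'I_(4 * k + 9)}} :=
  if i == 2 * k + 3 then C_2k3 k
  else if i == 2 * k + 5 then C_2k5 k
  else P _ i.

Definition C (k : nat) : {set {set 'I_(4 * k + 9)}} :=
  \bigcup_(2 * k + 3 <= i < (4 * k + 9).+1 | odd i) C_ k i.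

(* Main.v *)
Require Import Defs.
From mathcomp Require Import all_boot zify.

(** The many cases in the description of [C k] come from a single threshold
    condition.  Call a subset of the ground set lined when it contains one of
    the lines A_1, ..., A_7.  Then a set X of odd size is in [C k] exactly when
    X has at least 2k points in [low k] if it is lined, and at least 2k+3 points
    there if it is not (lemma [mem_C]).

    This rests on two properties of the Fano plane: two lines always meet
    ([lines_meet]), and in a 2-colouring of its points some line is
    monochromatic ([has_line_or_compl]).  Together they say that, of a subset of
    the plane and its complement, exactly one is lined ([has_line_compl]).
    Hence a lined set has at least 3 points in the plane, and a set that is not
    lined has at most 4; a 4-subset is lined unless its complement is a line,
    i.e. unless it is one of the E_i, so Q_7(4) consists of the lined 4-subsets.

    The three required properties follow from the threshold description.
    - A superset of a lined set is lined, lined sets have the lower threshold,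
      and enlarging a set can only add points of [low k]: so the threshold
      condition is inherited by supersets, and adding a disjoint even set keeps
      the parity.
    - Disjoint sets are not both lined, so two disjoint members would have at
      least 2k + (2k+3) points in [low k], which has only 4k+2 points.
    - Let X be odd and not a member.  If X is lined, it leaves at least 2k+3
      points of [low k] free, and 2k+3 of these form a member.  Otherwise some
      line is disjoint from X, and at least 2k points of [low k] are free; the
      line with 2k of these is a member. *)

(** * The Fano plane on the numbers 3, ..., 9 *)

Definition fano_lines : seq (seq nat) :=
  [:: [:: 3; 4; 7]; [:: 3; 5; 8]; [:: 3; 6; 9]; [:: 4; 5; 9];
      [:: 5; 6; 7]; [:: 7; 8; 9]; [:: 4; 6; 8]].

Lemma fano_lines_meet :
  all (fun l => all (fun m => has (mem l) m) fano_lines) fano_lines.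
Proof. by []. Qed.

(** The Fano plane is not 2-colourable; there are only 128 colourings. *)
Lemma fano_monochromatic (c : nat -> bool) :
  has (fun l => all c l || all (predC c) l) fano_lines.
Proof.
rewrite /=.
by case: (c 3); case: (c 4); case: (c 5); case: (c 6); case: (c 7);
   case: (c 8); case: (c 9).
Qed.

(** * Finite sets *)

Lemma subset_of_card (T : finType) (A : {set T}) (j : nat) :
  j <= #|A| -> exists2 S : {set T}, S \subset A & #|S| = j.
Proof.
case/card_geqP=> s [uniq_s size_s sA]; exists [set x in s].
  by apply/subsetP => x; rewrite inE => /sA.
by rewrite cardsE (card_uniqP uniq_s).
Qed.

Lemma mem_bigcup_seq (T : finType) (I : Type) (r : seq I) (Q : pred I)
    (F : I -> {set T}) (x : T) :
  (x \in \bigcup_(i <- r | Q i) F i) = has (fun i => Q i && (x \in F i)) r.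
Proof.
rewrite -big_has_cond.
by apply: (big_morph (fun D : {set T} => x \in D)) => [A B|]; rewrite inE.
Qed.

(** * The plane inside the ground set *)

Section FanoSystem.

Set Implicit Arguments.
Unset Strict Implicit.

Variable k : nat.

Implicit Types (X Y Z L : {set 'I_(4 * k + 9)}) (l m : seq nat).

Lemma label_inj : injective (@label (4 * k + 9)).
Proof. by move=> x y [] /val_inj. Qed.

Lemma label_onto (a : nat) :
  3 <= a <= 9 -> exists x : 'I_(4 * k + 9), label x = 4 * k + a.
Proof.
move=> a_range; have lt_n : (4 * k + a).-1 < 4 * k + 9 by lia.
by exists (Ordinal lt_n); rewrite /label /=; lia.
Qed.

Lemma card_block l :
  uniq l -> all (fun a => 3 <= a <= 9) l -> #|block k l| = size l.
Proof.
move=> uniq_l /allP l_range; rewrite cardE -(size_map (@label _)).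
rewrite -(size_map (addn (4 * k)) l); apply/perm_size/uniq_perm.
- by rewrite (map_inj_uniq label_inj) enum_uniq.
- by rewrite (map_inj_uniq (@addnI _)).
move=> b; apply/mapP/idP => [[x]|b_l].
  by rewrite mem_enum inE => xl ->.
case/mapP: (b_l) => a /l_range/label_onto[x def_x] def_b.
by exists x; rewrite ?mem_enum ?inE def_x -def_b.
Qed.

Lemma T7_block : T7 k = block k (iota 3 7).
Proof.
apply/setP => x; rewrite [LHS]inE [RHS]inE; apply/idP/mapP => [x_range | [a]].
  by exists (label x - 4 * k); rewrite ?mem_iota; lia.
by rewrite mem_iota => a_range ->; lia.
Qed.

Lemma card_T7 : #|T7 k| = 7.
Proof. by rewrite T7_block card_block. Qed.

Lemma low_T7 : low k = ~: T7 k.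
Proof.
by apply/setP => x; rewrite !inE /label; have := ltn_ord x; lia.
Qed.

Lemma card_low : #|low k| = 4 * k + 2.
Proof. by have := cardsC (T7 k); rewrite -low_T7 card_T7 card_ord; lia. Qed.

Lemma card_T7_low X : #|X| = #|X :&: T7 k| + #|X :&: low k|.
Proof. by rewrite low_T7 -setDE cardsID. Qed.

Lemma T7_diff_block l :
  T7 k :\: block k l = block k [seq a <- iota 3 7 | a \notin l].
Proof.
apply/setP => x; rewrite T7_block in_setD ![x \in block _ _]inE.
apply/andP/mapP => [[xl /mapP[a a_range def_x]] | [a]].
  exists a => //; rewrite mem_filter a_range andbT.
  by apply: contra xl => a_l; rewrite def_x map_f.
rewrite mem_filter => /andP[a_l a_range] ->.
by rewrite (mem_map (@addnI _)) map_f.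
Qed.

(** * Lines *)

Lemma A_familyP L :
  reflect (exists2 l, l \in fano_lines & L = block k l) (L \in A_family k).
Proof.
have -> : (L \in A_family k) = (L \in map (block k) fano_lines).
  by rewrite !inE -!orbA.
exact: mapP.
Qed.

(** The E_i are the complements of the lines, listed in another order. *)
Lemma E_familyP L :
  reflect (exists2 l, l \in fano_lines & L = T7 k :\: block k l)
          (L \in E_family k).
Proof.
pose compl l := [seq a <- iota 3 7 | a \notin l].
pose E_lists := [:: [:: 3; 4; 8; 9]; [:: 4; 5; 7; 8]; [:: 5; 6; 8; 9];
  [:: 3; 5; 7; 9]; [:: 3; 4; 5; 6]; [:: 3; 6; 7; 8]; [:: 4; 6; 7; 9]].
have -> : (L \in E_family k) = (L \in map (block k) E_lists).
  by rewrite !inE -!orbA.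
have E_compl : perm_eq E_lists (map compl fano_lines) by [].
rewrite (perm_mem (perm_map _ E_compl)) -map_comp.
by apply: (iffP mapP) => -[l l_line ->]; exists l; rewrite ?T7_diff_block.
Qed.

Lemma line_sub_T7 L : L \in A_family k -> L \subset T7 k.
Proof.
case/A_familyP=> l l_line ->; apply/subsetP => x.
rewrite T7_block ![x \in block _ _]inE.
have sub: {subset l <= iota 3 7}.
  by apply/allP; move: l_line; apply/allP.
by case/mapP=> a /sub a_range ->; rewrite map_f.
Qed.

Lemma card_line L : L \in A_family k -> #|L| = 3.
Proof.
case/A_familyP=> l l_line ->.
have /and3P[uniq_l range_l /eqP size_l] :
    [&& uniq l, all (fun a => 3 <= a <= 9) l & size l == 3].
  by move: l l_line; apply/allP.
by rewrite card_block.
Qed.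

Lemma lines_meet L L' :
  L \in A_family k -> L' \in A_family k -> L :&: L' != set0.
Proof.
case/A_familyP=> l l_line -> /A_familyP[m m_line ->].
have /hasP[a a_m a_l] := allP (allP fano_lines_meet l l_line) m m_line.
have a_range: 3 <= a <= 9.
  have /allP : all (fun a => 3 <= a <= 9) m by move: m m_line {a_m}; apply/allP.
  exact.
have [x def_x] := label_onto a_range.
by apply/set0Pn; exists x; rewrite !inE def_x !map_f.
Qed.

Definition has_line X : bool := [exists L in A_family k, L \subset X].

Lemma has_lineS X Y : X \subset Y -> has_line X -> has_line Y.
Proof.
move=> sXY /exists_inP[L L_A sLX]; apply/exists_inP; exists L => //.
exact: subset_trans sXY.
Qed.

Lemma has_line_T7 X : has_line (X :&: T7 k) = has_line X.
Proof.
apply/idP/idP; first exact/has_lineS/subsetIl.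
case/exists_inP=> L L_A sLX; apply/exists_inP; exists L => //.
by rewrite subsetI sLX line_sub_T7.
Qed.

Lemma has_line_disjoint X Y : X :&: Y = set0 -> has_line X -> ~~ has_line Y.
Proof.
move=> XY0 /exists_inP[L L_A sLX]; apply/negP => /exists_inP[L' L'_A sL'Y].
by have := lines_meet L_A L'_A; rewrite -subset0 -XY0 setISS.
Qed.

(** Colour a point of the plane by its membership in [X]; a monochromatic line
    lies in [X] or in its complement.  The colouring is defined on the numbers
    [a] rather than on the points [4k+a], so that it does not depend on [k]. *)
Lemma has_line_or_compl X : has_line X || has_line (~: X).
Proof.
pose c a := [exists x in X, label x == 4 * k + a].
have /hasP[l l_line /orP mono] := fano_monochromatic c.
have L_A : block k l \in A_family k by apply/A_familyP; exists l.
case: mono => /allP c_l; apply/orP; [left|right];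
  apply/exists_inP; exists (block k l) => //;
  apply/subsetP => x; rewrite !inE => /mapP[a /c_l c_a def_x].
  case/exists_inP: c_a => y Xy /eqP; rewrite -def_x => /label_inj <- //.
by apply: contra c_a => Xx; apply/exists_inP; exists x; rewrite ?def_x.
Qed.

(** Containing a line is a self-dual property of subsets of the plane: this is
    what makes the system at once commutative and maximal. *)
Lemma has_line_compl X : has_line (T7 k :\: X) = ~~ has_line X.
Proof.
have -> : has_line (T7 k :\: X) = has_line (~: X).
  by rewrite setDE setIC has_line_T7.
apply/idP/idP; last by have := has_line_or_compl X; case: (has_line X).
by apply: has_line_disjoint; rewrite setIC setICr.
Qed.

Lemma has_line_card Z : has_line Z -> 3 <= #|Z|.
Proof.
by case/exists_inP=> L L_A /subset_leq_card; rewrite (card_line L_A).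
Qed.

Lemma A_familyE Z : (Z \in A_family k) = has_line Z && (#|Z| == 3).
Proof.
apply/idP/andP => [Z_A | [/exists_inP[L L_A sLZ] /eqP cardZ]].
  by rewrite (card_line Z_A); split=> //; apply/exists_inP; exists Z.
suff <- : L = Z by [].
by apply/eqP; rewrite eqEcard sLZ cardZ (card_line L_A).
Qed.

(** * The layers of the system in terms of lines *)

(** The complement of a 4-subset of the plane has 3 points, so it contains a
    line only by being one. *)
Lemma E_familyE Z : Z \subset T7 k -> #|Z| = 4 ->
  (Z \in E_family k) = ~~ has_line Z.
Proof.
move=> sZT cardZ; rewrite -has_line_compl.
have card_compl : #|T7 k :\: Z| = 3.
  by rewrite cardsD (setIidPr sZT) card_T7 cardZ.
transitivity (T7 k :\: Z \in A_family k); last first.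
  by rewrite A_familyE card_compl andbT.
have complK (W : {set 'I_(4 * k + 9)}) :
    W \subset T7 k -> T7 k :\: (T7 k :\: W) = W.
  by move=> sWT; rewrite setDDr setDv set0U (setIidPr sWT).
apply/E_familyP/A_familyP => -[l l_line def_Z]; exists l => //.
  rewrite def_Z complK // line_sub_T7 //.
  by apply/A_familyP; exists l.
by rewrite -def_Z complK.
Qed.

Lemma Q7_4E Z : Z \subset T7 k ->
  (Z \in Q7_4 k) = has_line Z && (#|Z| == 4).
Proof.
move=> sZT; rewrite in_setD [Z \in subsets_of_size _ _]inE sZT andbC /=.
by case: eqP => [/(E_familyE sZT)->|]; rewrite ?negbK ?andbT ?andbF.
Qed.

(** The bound 4 is dual to the bound 3: the plane minus a set without a line
    contains a line. *)
Lemma card_T7_bounds X :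
  if has_line X then 3 <= #|X :&: T7 k| <= 7 else #|X :&: T7 k| <= 4.
Proof.
have := subset_leq_card (subsetIr X (T7 k)); rewrite card_T7 => le7.
rewrite -has_line_T7; case: ifP => [/has_line_card-> //|/negbT].
rewrite -has_line_compl => /has_line_card.
rewrite cardsD (setIidPr (subsetIr _ _)) card_T7; lia.
Qed.

(** As [T7 k] and [low k] are complementary, a decomposition of [X] can only be
    the one into [X :&: T7 k] and [X :&: low k]. *)
Lemma unionsE (F : {set {set 'I_(4 * k + 9)}}) j X :
  (forall Z, Z \in F -> Z \subset T7 k) ->
  (X \in unions F (subsets_of_size (low k) j)) =
    (X :&: T7 k \in F) && (#|X :&: low k| == j).
Proof.
move=> FT; apply/imset2P/andP => [[Z S Z_F] | [XF Xj]].
  rewrite inE => /andP[sSL cardS] ->; have sZT := FT _ Z_F.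
  have S_T : S :&: T7 k = set0.
    by apply/eqP; rewrite setI_eq0 disjoints_subset -low_T7.
  have Z_L : Z :&: low k = set0.
    by apply/eqP; rewrite setI_eq0 disjoints_subset low_T7 setCK.
  by rewrite !setIUl S_T Z_L setU0 set0U (setIidPl sZT) (setIidPl sSL).
exists (X :&: T7 k) (X :&: low k) => //; first by rewrite inE subsetIr.
by rewrite -setIUr low_T7 setUCr setIT.
Qed.

Lemma sub_lowE X : (X \subset low k) = (#|X :&: T7 k| == 0).
Proof. by rewrite cards_eq0 setI_eq0 disjoints_subset low_T7. Qed.

(** Among sets of size 2k+3, the bound 2k for sets with a line leaves at most 3
    points in the plane, hence just the line; the bound 2k+3 for the others
    leaves none. *)
Lemma mem_C_2k3 X : #|X| = 2 * k + 3 ->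
  (X \in C_2k3 k) = ((if has_line X then 2 * k else 2 * k + 3)
                       <= #|X :&: low k|).
Proof.
move=> cardX; rewrite !inE subsetT cardX eqxx /= sub_lowE andbT.
rewrite unionsE; last exact: line_sub_T7.
rewrite A_familyE has_line_T7; have := card_T7_low X; rewrite cardX.
by have := card_T7_bounds X; case: has_line => /=; lia.
Qed.

(** Among sets of size 2k+5, the bound 2k for sets with a line allows 3, 4 or 5
    points in the plane, and these give the layers of the lines, of Q_7(4) and
    of all 5-subsets; the bound 2k+3 for the others gives the layers with at most
    2 points. *)
Lemma mem_C_2k5 X : #|X| = 2 * k + 5 ->
  (X \in C_2k5 k) = ((if has_line X then 2 * k else 2 * k + 3)
                       <= #|X :&: low k|).
Proof.
move=> cardX; rewrite in_setI [X \in P _ _]inE subsetT cardX eqxx /= !in_setU.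
have subT j Z : Z \in subsets_of_size (T7 k) j -> Z \subset T7 k.
  by rewrite inE => /andP[].
rewrite !unionsE; try exact: subT; first last.
- exact: line_sub_T7.
- by move=> Z /setDP[/subT].
rewrite A_familyE Q7_4E ?subsetIr // !inE subsetIr has_line_T7 /=.
have := card_T7_low X; rewrite cardX.
by have := card_T7_bounds X; case: has_line => /=; lia.
Qed.

(** For the odd sizes other than 2k+3 and 2k+5 the threshold condition depends on
    the size only.  From size 2k+7 on it always holds, since a set has at most 7
    points in the plane, and at most 4 if it contains no line; below size 2k+3
    it never holds, since a set containing a line has at least 3 points in the
    plane. *)
Lemma mem_C X :
  (X \in C k) = odd #|X| && ((if has_line X then 2 * k else 2 * k + 3)
                               <= #|X :&: low k|).
Proof.
have C_card i : X \in C_ k i -> #|X| = i.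
  have C_P : C_ k i \subset P _ i.
    rewrite /C_; case: eqP => [->|_]; first exact: subsetIl.
    by case: eqP => [->|_]; first exact: subsetIl.
  by move/(subsetP C_P); rewrite inE => /andP[_ /eqP].
have le_n : #|X| < (4 * k + 9).+1 by rewrite ltnS -[leqRHS]card_ord max_card.
have -> : (X \in C k) = [&& 2 * k + 3 <= #|X|, odd #|X| & X \in C_ k #|X|].
  rewrite mem_bigcup_seq; apply/hasP/and3P => [[i] | [ge_X odd_X X_C]].
    by rewrite mem_index_iota => /andP[i_ge _] /andP[odd_i /[dup] /C_card->].
  by exists #|X|; rewrite ?odd_X ?X_C // mem_index_iota ge_X.
have cardX := card_T7_low X.
rewrite /C_; case: eqP => [/[dup] eqX /mem_C_2k3->|ne3].
  by rewrite eqX leqnn.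
case: eqP => [/[dup] eqX /mem_C_2k5->|ne5].
  by rewrite eqX leq_add2l.
rewrite inE subsetT eqxx /= andbT andbC.
case odd_X: (odd #|X|) => //=.
move: (card_T7_bounds X) odd_X cardX ne3 ne5; clear.
move: #|X :&: T7 k| #|X :&: low k| #|X| => t s n.
by case: has_line; lia.
Qed.

(** * The three properties of the system *)

Lemma C_algebraic : algebraic_system (C k).
Proof.
split=> [|A|A1 A2 even_A1].
- (* The whole ground set is a member; [card_T7_bounds] shows that it contains
     a line, as it has 7 points in the plane. *)
  apply/set0Pn; exists setT; rewrite mem_C setTI card_low cardsT card_ord.
  by have := card_T7_bounds setT; rewrite setTI card_T7; case: has_line; lia.
- by rewrite mem_C => /andP[].
rewrite !mem_C => /andP[odd_A2 ge_A2] A12; apply/andP; split.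
  by rewrite cardsU A12 cards0 subn0 oddD odd_A2 (negbTE even_A1).
apply: leq_trans (subset_leq_card (setSI (low k) (subsetUr A1 A2))).
apply: leq_trans ge_A2.
have := has_lineS (subsetUr A1 A2); case: (has_line A2) => [-> //|_].
by case: has_line => //; rewrite leq_addr.
Qed.

Lemma C_commutative : commutative_system (C k).
Proof.
move=> A B; rewrite !mem_C => /andP[_ geA] /andP[_ geB].
apply/negP => /eqP AB0.
have : #|A :&: low k| + #|B :&: low k| <= 4 * k + 2.
  rewrite -cardsUI -setIIl AB0 set0I cards0 addn0 -setIUl -card_low.
  by rewrite subset_leq_card ?subsetIr.
have not_both : ~~ (has_line A && has_line B).
  by apply/andP => -[/(has_line_disjoint AB0)/negP].
move: not_both geA geB.
by case: (has_line A); case: (has_line B) => //= _; lia.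
Qed.

Lemma C_maximal : maximal_system (C k).
Proof.
move=> A odd_A; rewrite mem_C odd_A /= -ltnNge => lt_A.
have cardA : #|low k :\: A| = 4 * k + 2 - #|A :&: low k|.
  by rewrite cardsD card_low setIC.
move: #|A :&: low k| lt_A cardA => s lt_s cardA.
case line_A: (has_line A) lt_s => /= lt_s.
- (* The bound 2k+3 suffices for membership, whether or not [S] has a line. *)
  have [|S] := @subset_of_card _ (low k :\: A) (2 * k + 3).
    by rewrite cardA; lia.
  rewrite subsetD => /andP[sSL dSA] cardS.
  exists S; last by apply/eqP; rewrite setIC setI_eq0.
  by rewrite mem_C (setIidPl sSL) cardS; case: ifP => _; lia.
have /exists_inP[L L_A] : has_line (T7 k :\: A).
  by rewrite has_line_compl line_A.
rewrite subsetD => /andP[sLT dLA].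
have [|S] := @subset_of_card _ (low k :\: A) (2 * k).
  by rewrite cardA; lia.
rewrite subsetD => /andP[sSL dSA] cardS.
exists (L :|: S); last first.
  apply/eqP; rewrite setIC setIUl setU_eq0 !setI_eq0; exact/andP.
have LS0 : L :&: low k = set0.
  by apply/eqP; rewrite setI_eq0 disjoints_subset low_T7 setCK.
have LS : #|L :|: S| = 3 + 2 * k.
  rewrite cardsU (card_line L_A) cardS.
  suff -> : L :&: S = set0 by rewrite cards0 subn0.
  by apply/eqP; rewrite -subset0 -LS0 setIS.
have line_LS : has_line (L :|: S).
  by apply/exists_inP; exists L; rewrite ?subsetUl.
rewrite mem_C LS line_LS setIUl LS0 set0U (setIidPl sSL) cardS leqnn andbT.
by lia.
Qed.

End FanoSystem.

Theorem corollary3 (k : nat) (hk : 2 <= k) :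
  C k \subset Pstar (4 * k + 9) /\ maximal_commutative_algebraic_system (C k).
Proof.
have C_alg := C_algebraic k.
split; last by split=> //; [apply: C_commutative | apply: C_maximal].
apply/subsetP => A; rewrite inE; case: C_alg => _ odd_C _ /odd_C.
by apply: contraTneq => ->; rewrite cards0.
Qed.
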